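(* For all integers $r\ge s\ge 0$ there is a number $n_{r,s}$ such that the following holds. Let $G$ be an $r$-graph and let $x\ge r$ be a real number with $|G|=\binom{x}{r}\ge n_{r,s}$. Then $\operatorname{rk} M^r_s(G)\ge\binom{x}{s}$. Moreover, if $r>s>0$, then equality $\operatorname{rk} M^r_s(G)=\binom{x}{s}$ holds only if $x$ is an integer and $G=K^r_x$, i.e. the edge set of $G$ consists of all $r$-element subsets of some $x$-element set of vertices.
   Context: An $r$-graph $G$ consists of a finite vertex set $V(G)$ and a set $E(G)$ of edges, each edge being an $r$-element subset of $V(G)$; $|G|=|E(G)|$. For $s\le r$ the inclusion matrix $M^r_s(G)$ is the $\{0,1\}$-matrix with rows indexed by the edges of $G$ and columns indexed by the $s$-element subsets of $V(G)$, whose entry in row $e$ and column $S$ is $1$ if $S\subset e$ and $0$ otherwise; $\operatorname{rk}$ denotes its rank over the rational numbers. $K^r_x$ is the complete $r$-graph on $x$ vertices; $G=K^r_x$ is understood up to isolated vertices (vertices in no edge). For real $x$ and integer $k\ge 0$, $\binom{x}{k}=x(x-1)\cdots(x-k+1)/k!$. *)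

(* Defs.v *)
From mathcomp Require Import all_boot all_order all_algebra reals.

Set Implicit Arguments.
Unset Strict Implicit.
Unset Printing Implicit Defensive.

Import GRing.Theory.
Local Open Scope ring_scope.

(* A hypergraph is given by its edge set [E : {set {set T}}]; its vertex set is
   the whole of the finite type [T], so isolated vertices are allowed. *)
Definition uniform (T : finType) (r : nat) (E : {set {set T}}) : Prop :=
  forall e, e \in E -> #|e| = r.

Definition subsets_of_card (T : finType) (k : nat) (X : {set T}) :
    {set {set T}} :=
  [set A : {set T} | (A \subset X) && (#|A| == k)].

Definition inclusion_mx (T : finType) (s : nat) (E : {set {set T}}) :
    'M[rat]_(#|E|, #|subsets_of_card s [set: T]|) :=
  \matrix_(i < #|E|, j < #|subsets_of_card s [set: T]|)
    ((enum_val j : {set T}) \subset (enum_val i : {set T}))%:R.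

Definition rbinom (R : realType) (x : R) (k : nat) : R :=
  (\prod_(i < k) (x - i%:R)) / (k`!)%:R.

(* Main.v *)
Require Import Defs.
From mathcomp Require Import all_boot all_order all_algebra reals.
From mathcomp Require Import ring lra zify.

Set Implicit Arguments.
Unset Strict Implicit.
Unset Printing Implicit Defensive.

Import Order.TTheory GRing.Theory Num.Theory.
Local Open Scope ring_scope.

(* Write b_k(y) for [rbinom y k] and N for the number of non-isolated vertices,
   so that x <= N.  Induction on s: ordering rows and columns by whether they
   contain a vertex v makes the inclusion matrix block triangular, whence
   rk_s(G) >= rk_(s-1)(link of v) + rk_s(G - v).
   Take v of minimum degree d <= (x / N) b_(r-1)(x-1), let b_r(z) = |G - v| and
   b_(r-1)(u) = d.  By induction the link contributes at least b_(s-1)(u), and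
   concavity of b_s as a function of b_r gives
   b_s(x) - b_s(z) <= d b_(s-1)(x-1) / b_(r-1)(x-1) <= b_(s-1)(u).
   So the deficit b_s(x) - rk_s(G) does not decrease when v is deleted.  If it
   increases by less than 1 / (K x), then N - x is so small that G misses fewer
   than epsilon N^(r-s) r-subsets of its vertex set, and Gottlieb's theorem applied
   to complete subgraphs on r + s vertices shows that the rank is full, b_s(N).
   Otherwise one repeats; as x drops by at most 1 per step and the harmonic
   series diverges, a positive deficit of a large G would exceed the trivial
   bound available when x reaches a constant. *)

(** * Binomial coefficients of a real argument *)

Lemma rbinom0 (R : realType) (x : R) : rbinom x 0 = 1.
Proof. by rewrite /rbinom big_ord0 fact0 divr1. Qed.

Lemma rbinomS (R : realType) (x : R) (k : nat) :
  k.+1%:R * rbinom x k.+1 = (x - k%:R) * rbinom x k.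
Proof.
rewrite /rbinom big_ord_recr /= factS natrM invfM.
have k1 : (k.+1%:R : R) != 0 by rewrite pnatr_eq0.
have kf : (k`!%:R : R) != 0 by rewrite pnatr_eq0 -lt0n fact_gt0.
move: k1 kf; move: k.+1%:R k`!%:R => a b a0 b0.
by field; rewrite a0 b0.
Qed.

Lemma rbinomSE (R : realType) (x : R) (k : nat) :
  rbinom x k.+1 = (x - k%:R) / k.+1%:R * rbinom x k.
Proof.
have k1 : (k.+1%:R : R) != 0 by rewrite pnatr_eq0.
by apply: (mulfI k1); rewrite rbinomS; move: k.+1%:R k1 => c c0; field.
Qed.

Lemma rbinom_absorb (R : realType) (x : R) (k : nat) :
  k.+1%:R * rbinom x k.+1 = x * rbinom (x - 1) k.
Proof.
elim: k x => [|k IH] x; first by rewrite rbinomS !rbinom0 subr0.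
rewrite rbinomS (rbinomSE (x - 1)) [in LHS]rbinomSE.
have -> : (x - k.+1%:R) * ((x - k%:R) / k.+1%:R * rbinom x k) =
  (x - k.+1%:R) / k.+1%:R * ((x - k%:R) * rbinom x k) by ring.
rewrite -rbinomS IH (_ : x - 1 - k%:R = x - k.+1%:R); first by ring.
by rewrite -[k.+1]addn1 natrD; ring.
Qed.

Lemma rbinom_pascal (R : realType) (x : R) (k : nat) :
  rbinom x k.+1 = rbinom (x - 1) k.+1 + rbinom (x - 1) k.
Proof.
apply: (@mulfI _ k.+1%:R); first by rewrite pnatr_eq0.
by rewrite rbinom_absorb mulrDr rbinomS -[k.+1]addn1 natrD; ring.
Qed.

Lemma rbinom_nat (R : realType) (n k : nat) :
  rbinom (n%:R : R) k = 'C(n, k)%:R.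
Proof.
elim: k n => [|k IH] n; first by rewrite rbinom0 bin0.
case: n => [|n]; first by rewrite /rbinom big_ord_recl /= subr0 mul0r mul0r.
apply: (@mulfI _ k.+1%:R); first by rewrite pnatr_eq0.
rewrite rbinom_absorb -natrM -mul_bin_diag natrM -IH.
by rewrite /= -natr1 addrK.
Qed.

Lemma rbinom_ge0 (R : realType) (x : R) (k : nat) :
  k%:R <= x + 1 -> 0 <= rbinom x k.
Proof.
move=> hx; apply: divr_ge0; last exact: ler0n.
apply: prodr_ge0 => i _; rewrite subr_ge0.
have : i.+1%:R <= k%:R :> R by rewrite ler_nat.
by rewrite -[i.+1]addn1 natrD; lra.
Qed.

Lemma rbinom_gt0 (R : realType) (x : R) (k : nat) :
  k%:R <= x -> 0 < rbinom x k.
Proof.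
move=> hx; apply: divr_gt0; last by rewrite ltr0n fact_gt0.
apply: prodr_gt0 => i _; rewrite subr_gt0.
by apply: lt_le_trans hx; rewrite ltr_nat.
Qed.

Lemma rbinom_le (R : realType) (x y : R) (k : nat) :
  k%:R <= x + 1 -> x <= y -> rbinom x k <= rbinom y k.
Proof.
move=> hx xy; rewrite ler_pM2r; last by rewrite invr_gt0 ltr0n fact_gt0.
apply: ler_prod => i _.
have : i.+1%:R <= k%:R :> R by rewrite ler_nat.
by rewrite -[i.+1]addn1 natrD => h; apply/andP; split; lra.
Qed.

Lemma rbinom_lt (R : realType) (x y : R) (k : nat) : (0 < k)%N ->
  k%:R <= x + 1 -> x < y -> rbinom x k < rbinom y k.
Proof.
case: k => // k _; rewrite -[k.+1]addn1 natrD addn1 => hx xy.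
rewrite !rbinomSE.
have k1 : 0 < k.+1%:R^-1 :> R by rewrite invr_gt0 ltr0n.
have hle : rbinom x k <= rbinom y k by apply: rbinom_le; lra.
have h0 : 0 <= rbinom x k by apply: rbinom_ge0; lra.
have hy : 0 < rbinom y k by apply: rbinom_gt0; lra.
apply: (@le_lt_trans _ _ ((x - k%:R) / k.+1%:R * rbinom y k)).
  by apply: ler_wpM2l => //; apply: mulr_ge0; [lra | exact: ltW].
by rewrite ltr_pM2r // ltr_pM2r //; lra.
Qed.

Lemma rbinom_ge1 (R : realType) (x : R) (k : nat) : k%:R <= x -> 1 <= rbinom x k.
Proof.
move=> hx; rewrite -[1](_ : 'C(k, k)%:R = 1); last by rewrite binn.
by rewrite -rbinom_nat rbinom_le //; lra.
Qed.

Lemma rbinom_ivt (R : realType) (k : nat) (a b c : R) :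
  a <= b -> rbinom a k <= c <= rbinom b k ->
  exists2 z, a <= z <= b & rbinom z k = c.
Proof.
move=> ab /andP[ac cb].
pose p : {poly R} := (k`!)%:R^-1 *: \prod_(i < k) ('X - (i%:R)%:P) - c%:P.
have pE y : p.[y] = rbinom y k - c.
  rewrite /p hornerD hornerN hornerC hornerZ horner_prod mulrC /rbinom.
  by congr (_ / _ - _); apply: eq_bigr => i _; rewrite hornerXsubC.
have [|z hz /rootP rz] := @poly_ivt R p a b ab.
  by rewrite !pE subr_le0 subr_ge0 ac.
by exists z => //; move: rz; rewrite pE => /eqP; rewrite subr_eq0 => /eqP.
Qed.

(** * Comparison of binomials of different orders *)

(** Equality holds at both ends [z = x] and [z = x - 1]. In the induction step the slack is a
    multiple of (x - z)(1 - (x - z)), which is nonnegative in between. *)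
Lemma rbinom_slope_step (R : realType) (x z : R) (j : nat) :
  j%:R <= x -> x - 1 <= z -> z <= x ->
  rbinom x j * (x - j%:R) <= rbinom z j * (x - j%:R + j%:R * (x - z)).
Proof.
move=> jx zx1 zx; elim: j jx => [|j IH]; first by rewrite !rbinom0; lra.
rewrite -natr1 => jx; have {IH}IH := IH ltac:(lra).
rewrite !rbinomSE -natr1.
have b0 : 0 <= rbinom z j by apply: rbinom_ge0; lra.
have j0 : 0 <= j%:R :> R by apply: ler0n.
move: (rbinom x j) (rbinom z j) IH b0 => X Z IH Z0.
have -> : (x - j%:R) / (j%:R + 1) * X * (x - (j%:R + 1)) =
  X * (x - j%:R) * (x - j%:R - 1) / (j%:R + 1) by ring.
have -> : (z - j%:R) / (j%:R + 1) * Z * (x - (j%:R + 1) + (j%:R + 1) * (x - z)) =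
  Z * (z - j%:R) * (x - j%:R - 1 + (j%:R + 1) * (x - z)) / (j%:R + 1) by ring.
rewrite ler_pM2r; last by rewrite invr_gt0; lra.
apply: (@le_trans _ _ (Z * (x - j%:R + j%:R * (x - z)) * (x - j%:R - 1))).
  by apply: ler_wpM2r => //; lra.
rewrite -subr_ge0.
have -> : Z * (z - j%:R) * (x - j%:R - 1 + (j%:R + 1) * (x - z)) -
   Z * (x - j%:R + j%:R * (x - z)) * (x - j%:R - 1) =
   Z * ((j%:R + 1) * (x - z) * (1 - (x - z))) by ring.
by rewrite mulr_ge0 // mulr_ge0 ?mulr_ge0 //; lra.
Qed.

(** Equivalently, for positive orders, the relative drop (1 - b_j(z) / b_j(x)) / j is nondecreasing
    in [j]; clearing denominators reduces this to [rbinom_slope_step]. *)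
Lemma rbinom_slope_succ (R : realType) (x z : R) (j : nat) :
  j%:R <= x -> x - 1 <= z -> z <= x ->
  j.+1%:R * (rbinom x j - rbinom z j) * rbinom x j.+1 <=
  j%:R * (rbinom x j.+1 - rbinom z j.+1) * rbinom x j.
Proof.
move=> jx zx1 zx; have h := rbinom_slope_step jx zx1 zx.
have b0 : 0 <= rbinom x j by apply: rbinom_ge0; lra.
have j0 : 0 <= j%:R :> R by apply: ler0n.
rewrite !rbinomSE -natr1.
move: (rbinom x j) (rbinom z j) h b0 => X Z h X0.
rewrite -subr_ge0.
have j1 : j%:R + 1 != 0 :> R by lra.
have -> : j%:R * ((x - j%:R) / (j%:R + 1) * X - (z - j%:R) / (j%:R + 1) * Z) * X -
   (j%:R + 1) * (X - Z) * ((x - j%:R) / (j%:R + 1) * X) =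
   X * (Z * (x - j%:R + j%:R * (x - z)) - X * (x - j%:R)) / (j%:R + 1) by field.
by rewrite divr_ge0 ?mulr_ge0 //; lra.
Qed.

Lemma rbinom_slope_aux (R : realType) (x z : R) (s r : nat) :
  (0 < s)%N -> (s <= r)%N -> r%:R <= x -> x - 1 <= z -> z <= x ->
  r%:R * (rbinom x s - rbinom z s) * rbinom x r <=
  s%:R * (rbinom x r - rbinom z r) * rbinom x s.
Proof.
move=> s0 /subnKC <-; elim: (r - s)%N => [|k IH]; first by rewrite addn0.
rewrite addnS -[(s + k).+1%:R]natr1; set r' := (s + k)%N in IH * => rx zx1 zx.
have {}IH := IH ltac:(lra) zx1 zx.
have h := @rbinom_slope_succ _ x z r' ltac:(lra) zx1 zx.
have r0 : 0 < r'%:R :> R by rewrite ltr0n addn_gt0 s0.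
have Xr : 0 < rbinom x r' by apply: rbinom_gt0; lra.
have Xr' : 0 < rbinom x r'.+1 by apply: rbinom_gt0; rewrite -natr1; lra.
have Xs : 0 < rbinom x s.
  by apply: rbinom_gt0; apply: le_trans (_ : r'%:R <= _); rewrite ?ler_nat ?leq_addr //; lra.
rewrite -(@ler_pM2l _ (r'%:R * rbinom x r')); last exact: mulr_gt0.
apply: (@le_trans _ _ ((r'%:R + 1) * rbinom x r'.+1 *
   (s%:R * (rbinom x r' - rbinom z r') * rbinom x s))).
  rewrite -subr_ge0; rewrite -subr_ge0 in IH.
  have := mulr_ge0 (mulr_ge0 (ler0n R r'.+1) (ltW Xr')) IH.
  by congr (0 <= _); ring.
rewrite -subr_ge0; rewrite -subr_ge0 in h.
have := mulr_ge0 (mulr_ge0 (ler0n R s) (ltW Xs)) h.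
by congr (0 <= _); ring.
Qed.

(** Concavity of b_(s+1) in terms of b_(r+1): by Pascal's rule the chord from [x - 1] to [x] has
    slope b_s(x-1) / b_r(x-1), and the chord from [z] to [x] is no steeper. *)
Lemma rbinom_slope (R : realType) (x z : R) (s r : nat) :
  (s <= r)%N -> r.+1%:R <= x -> x - 1 <= z -> z <= x ->
  (rbinom x s.+1 - rbinom z s.+1) * rbinom (x - 1) r <=
  (rbinom x r.+1 - rbinom z r.+1) * rbinom (x - 1) s.
Proof.
move=> sr rx zx1 zx.
have := @rbinom_slope_aux _ x z s.+1 r.+1 isT sr rx zx1 zx.
rewrite mulrAC rbinom_absorb [X in _ <= X]mulrAC rbinom_absorb.
have x0 : 0 < x by apply: lt_le_trans rx; rewrite ltr0n.
by rewrite -![x * _ * _]mulrA ler_pM2l // ![_ * (rbinom x _ - _)]mulrC.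
Qed.

(** With P_j = b_j(u) / b_j(w) the claim reads P_k (1 - P_(n+1)) <= (n+1) (P_k - P_(n+1)), a
    quantitative form of P_(n+1) <= P_k. It turns a small surplus of the link's rank into a small
    gap between the degree and b_r(x-1). *)
Lemma rbinom_gain (R : realType) (u w : R) (k n : nat) :
  (k <= n)%N -> n.+1%:R <= u -> u <= w ->
  rbinom u k * (rbinom w n.+1 - rbinom u n.+1) <=
  n.+1%:R * (rbinom u k * rbinom w n.+1 - rbinom w k * rbinom u n.+1).
Proof.
move=> kn nu uw.
pose P j := rbinom u j / rbinom w j.
pose a j : R := (u - j%:R) / (w - j%:R).
have lenat (j : nat) : (j <= n)%N -> j%:R + 1 <= u.
  by move=> jn; rewrite natr1; apply: le_trans nu; rewrite ler_nat.
have W0 (j : nat) : (j <= n.+1)%N -> 0 < rbinom w j.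
  by move=> jn; apply: rbinom_gt0; apply: le_trans uw; apply: le_trans nu; rewrite ler_nat.
have U0 (j : nat) : (j <= n.+1)%N -> 0 < rbinom u j.
  by move=> jn; apply: rbinom_gt0; apply: le_trans nu; rewrite ler_nat.
have P0 (j : nat) : (j <= n.+1)%N -> 0 < P j by move=> jn; rewrite divr_gt0 ?W0 ?U0.
have PS (j : nat) : (j <= n)%N -> P j.+1 = P j * a j.
  move=> jn; rewrite /P /a !rbinomSE.
  have := lenat _ jn; have := W0 j (leqW jn); have : 0 < j.+1%:R :> R by rewrite ltr0n.
  move: (rbinom w j) (rbinom u j) (j.+1%:R) => W U J J0 W_0 ju.
  by field; apply/and3P; split; lra.
have a01 (j : nat) : (j <= n)%N -> 0 <= a j <= 1.
  move=> jn; have := lenat _ jn => ju.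
  by rewrite /a divr_ge0 /= ?ler_pdivrMr; lra.
have aS (j : nat) : (j < n)%N -> a j.+1 <= a j.
  move=> jn; have := lenat _ jn; rewrite /a -natr1 => ju.
  rewrite ler_pdivrMr; last lra.
  rewrite mulrAC ler_pdivlMr; last lra.
  rewrite -subr_ge0; move: (j%:R) ju => J ju.
  by rewrite (_ : _ - _ = w - u); [lra | ring].
(* P_(j+1) is a product of j+1 factors a_i in [0, 1], the smallest being a_j, so its loss from 1 is
   at most the sum of the 1 - a_i. *)
have Plow (j : nat) : (j <= n)%N -> 1 - P j.+1 <= j.+1%:R * (1 - a j).
  elim: j => [|j IH] jn.
    by rewrite PS // /P !rbinom0 divr1 !mul1r.
  rewrite PS //.
  have h1 := IH (ltnW jn); have h2 := aS _ jn; have h3 := a01 _ jn.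
  have h4 := P0 _ (leqW jn).
  have P1 : P j.+1 <= 1.
    rewrite /P ler_pdivrMr ?mul1r; last by apply: W0; apply: leqW.
    by apply: rbinom_le => //; have := lenat _ jn; lra.
  have h5 : j.+1%:R * (1 - a j) <= j.+1%:R * (1 - a j.+1).
    by apply: ler_wpM2l => //; lra.
  have h6 : P j.+1 * (1 - a j.+1) <= 1 - a j.+1.
    by rewrite -{2}[1 - a j.+1]mul1r; apply: ler_wpM2r => //; lra.
  rewrite -[j.+2%:R]natr1; move: (P j.+1) (a j.+1) h1 h2 h3 h4 P1 h5 h6 => p b *.
  by rewrite mulrDl mul1r; nra.
have Pmono (m : nat) : (k + m <= n.+1)%N -> P (k + m)%N <= P k.
  elim: m => [|m IH]; rewrite ?addn0 // addnS => km.
  rewrite PS //; apply: le_trans (IH (ltnW km)).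
  by rewrite -{2}[P _]mulr1 ler_pM2l ?P0 ?(ltnW km) //; case/andP: (a01 _ km).
have Pn : P n.+1 <= P k * a n.
  rewrite PS //; apply: ler_wpM2r; first by case/andP: (a01 n (leqnn n)).
  by have := Pmono (n - k)%N; rewrite subnKC //; apply.
have Pfin : P k * (1 - P n.+1) <= n.+1%:R * (P k - P n.+1).
  have h := Plow n (leqnn n); have pk := P0 k (leqW kn).
  apply: (@le_trans _ _ (P k * (n.+1%:R * (1 - a n)))); first by rewrite ler_pM2l.
  by rewrite mulrCA ler_pM2l ?ltr0n // mulrBr mulr1 lerD2l lerN2.
have Wk := W0 k (leqW kn); have Wn := W0 n.+1 (leqnn _).
have := Pfin; rewrite -(ler_pM2r Wk) -(ler_pM2r Wn) /P.
have e1 : rbinom u k = P k * rbinom w k by rewrite /P divfK // gt_eqF.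
have e2 : rbinom u n.+1 = P n.+1 * rbinom w n.+1 by rewrite /P divfK // gt_eqF.
rewrite e1 e2 -/(P k) -/(P n.+1) !mulfK ?gt_eqF // => h.
by apply: le_trans (le_trans _ h) _; rewrite le_eqVlt; apply/orP; left; apply/eqP; ring.
Qed.

(** * Crude size estimates *)

Lemma rbinom_exp (R : realType) (x : R) (k : nat) :
  0 <= x -> k%:R <= x + 1 -> rbinom x k <= x ^+ k.
Proof.
move=> x0; elim: k => [|k IH]; first by rewrite rbinom0 expr0.
rewrite -natr1 => kx; rewrite exprS rbinomSE.
have k0 : 0 <= k%:R :> R by apply: ler0n.
apply: ler_pM; [by rewrite divr_ge0; lra | by apply: rbinom_ge0; lra | | by apply: IH; lra].
by rewrite ler_pdivrMr -?natr1; nra.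
Qed.

Lemma rbinom_diff (R : realType) (x y : R) (k : nat) :
  k%:R <= x -> x <= y -> rbinom y k.+1 - rbinom x k.+1 <= (y - x) * y ^+ k.
Proof.
move=> + xy; elim: k => [|k IH] kx; first by rewrite !rbinomSE !rbinom0 !divr1; lra.
have k0 : 0 <= k%:R :> R by apply: ler0n.
move: kx; rewrite -natr1 => kx; have {}IH := IH ltac:(lra).
have hx : rbinom x k.+1 <= y ^+ k.+1.
  apply: (@le_trans _ _ (x ^+ k.+1)); first by apply: rbinom_exp; rewrite -?natr1; lra.
  by apply: lerXn2r; rewrite ?nnegrE; lra.
have yk : 0 <= (y - x) * y ^+ k by rewrite mulr_ge0 ?exprn_ge0; lra.
rewrite [rbinom y k.+2]rbinomSE [rbinom x k.+2]rbinomSE mulrAC [X in _ - X]mulrAC.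
rewrite -mulrBl ler_pdivrMr ?ltr0n // -!natr1.
move: hx yk; rewrite exprS; move: (rbinom x k.+1) (rbinom y k.+1) (y ^+ k) IH => X Y p IH hx yk.
have h1 : (y - (k%:R + 1)) * (Y - X) <= y * ((y - x) * p).
  apply: (@le_trans _ _ ((y - (k%:R + 1)) * ((y - x) * p))).
    by apply: ler_wpM2l => //; lra.
  by apply: ler_wpM2r => //; lra.
have h2 : (y - x) * X <= (y - x) * (y * p) by apply: ler_wpM2l => //; lra.
have h3 : 0 <= y * ((y - x) * p) by rewrite mulr_ge0 //; lra.
have h4 : 0 <= k%:R * (y * ((y - x) * p)) by rewrite mulr_ge0.
have -> : (y - (k%:R + 1)) * Y - (x - (k%:R + 1)) * X =
  (y - (k%:R + 1)) * (Y - X) + (y - x) * X by ring.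
have -> : (y - x) * (y * p) * (k%:R + 1 + 1) = y * ((y - x) * p) + (y - x) * (y * p) +
   k%:R * (y * ((y - x) * p)) by ring.
lra.
Qed.

Lemma rbinom_double (R : realType) (x y : R) (k : nat) :
  k.*2%:R <= x -> x <= y -> y <= 2 * x -> rbinom y k <= 4 ^+ k * rbinom x k.
Proof.
move=> + xy yx; elim: k => [|k IH]; first by rewrite !rbinom0 expr0 mulr1.
rewrite doubleS => kx.
have {}kx : k%:R * 2 + 2 <= x by move: kx; rewrite -!natr1 -muln2 natrM; lra.
have k0 : 0 <= k%:R :> R by apply: ler0n.
have {}IH : rbinom y k <= 4 ^+ k * rbinom x k by apply: IH; rewrite -muln2 natrM; lra.
rewrite !rbinomSE exprS.
have -> : 4 * 4 ^+ k * ((x - k%:R) / k.+1%:R * rbinom x k) =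
  (4 * (x - k%:R)) / k.+1%:R * (4 ^+ k * rbinom x k) by ring.
apply: ler_pM => //; first by rewrite divr_ge0 //; lra.
  by apply: rbinom_ge0; lra.
by rewrite ler_pM2r ?invr_gt0 ?ltr0n //; lra.
Qed.

Lemma rbinom_lower (R : realType) (a y : R) (k : nat) :
  0 <= a -> a <= y - k%:R -> a ^+ k <= k`!%:R * rbinom y k.
Proof.
move=> a0; elim: k => [|k IH]; first by rewrite rbinom0 expr0 fact0 mulr1.
rewrite -natr1 => ay; have {}IH := IH ltac:(lra).
rewrite factS natrM mulrAC rbinomS exprS -mulrA.
by apply: ler_pM => //; rewrite ?exprn_ge0 //; first lra; rewrite mulrC.
Qed.

(** Passing from order j to j+1 multiplies j! b_j(w) by w - j, which is at least L. This makes the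
    loss from deleting a vertex of bounded degree small. *)
Lemma rbinom_growth (R : realType) (L w : R) (k n : nat) :
  (k < n)%N -> 1 <= L -> n%:R + L <= w -> L * rbinom w k <= n`!%:R * rbinom w n.
Proof.
move=> kn L1; have F1 (m : nat) : 1 <= m`!%:R :> R by rewrite ler1n fact_gt0.
elim: n kn => [//|n IH]; rewrite ltnS leq_eqVlt => h; rewrite -natr1 => nw.
have n0 : 0 <= n%:R :> R by apply: ler0n.
rewrite factS natrM mulrAC rbinomS mulrAC -mulrA.
have B0 : 0 <= rbinom w n by apply: rbinom_ge0; lra.
have FB : 0 <= n`!%:R * rbinom w n by rewrite mulr_ge0.
case/orP: h => [/eqP -> | kn].
  apply: ler_pM => //; [lra | lra |].
  by rewrite -{1}[rbinom w n]mul1r ler_wpM2r.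
apply: (le_trans (IH kn ltac:(lra))).
by rewrite -{1}[X in X <= _]mul1r ler_wpM2r //; lra.
Qed.


(** With [y] = N this is the counting hypothesis of [rank_full]. The left side is at most (y - x)
    y^r 4^(s+1) b_(s+1)(x), the right side at least (y/2)^(r+1) / (r+1)!; the factors of [K] are
    these constants and the 2r of the last hypothesis. *)
Lemma missing_bound (R : realType) (x y : R) (r s K : nat) :
  K = (4 ^ s.+1 * (r.*2 * (2 ^ r.+1 * r.+1`!)))%N ->
  (r + s + 2).*2%:R <= x -> x <= y -> y <= 2 * x ->
  K%:R * (rbinom x s.+1 * (y - x)) < r.*2%:R * y ->
  (rbinom y r.+1 - rbinom x r.+1) * rbinom y s.+1 < rbinom (y - s.+1%:R) r.+1.
Proof.
move=> Kdef + xy y2x hK; rewrite -muln2 natrM !natrD => hx.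
have r0 : 0 <= r%:R :> R by apply: ler0n.
have s0 : 0 <= s%:R :> R by apply: ler0n.
have h1 : rbinom y r.+1 - rbinom x r.+1 <= (y - x) * y ^+ r.
  by apply: rbinom_diff => //; lra.
have h2 : rbinom y s.+1 <= 4 ^+ s.+1 * rbinom x s.+1.
  by apply: rbinom_double => //; rewrite -muln2 natrM -natr1; lra.
have h3 : (y / 2) ^+ r.+1 <= r.+1`!%:R * rbinom (y - s.+1%:R) r.+1.
  by apply: rbinom_lower; rewrite -?[s.+1%:R]natr1 -?[r.+1%:R]natr1; lra.
have yr : 0 < y ^+ r by apply: exprn_gt0; lra.
(* For [r = 0] also [K = 0], and the strict hypothesis would read 0 < 0. *)
have r2 : 0 < r.*2%:R :> R.
  rewrite ltr0n lt0n; apply/negP => /eqP r20; move: hK.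
  by rewrite Kdef r20 mul0n muln0 !mul0r ltxx.
have p4 : 0 < 4 ^+ s.+1 :> R by apply: exprn_gt0; lra.
have p2 : 0 < 2 ^+ r.+1 :> R by apply: exprn_gt0; lra.
have rf : 0 < r.+1`!%:R :> R by rewrite ltr0n fact_gt0.
have bx : 0 <= rbinom x s.+1 by apply: rbinom_ge0; rewrite -natr1; lra.
have by0 : 0 <= rbinom y s.+1 by apply: rbinom_ge0; rewrite -natr1; lra.
apply: (@le_lt_trans _ _ ((y - x) * y ^+ r * (4 ^+ s.+1 * rbinom x s.+1))).
  apply: (@le_trans _ _ ((y - x) * y ^+ r * rbinom y s.+1)).
    exact: ler_wpM2r.
  by apply: ler_wpM2l => //; rewrite mulr_ge0 //; lra.
have h4 : 2 ^+ r.+1 * r.+1`!%:R * ((y - x) * y ^+ r * (4 ^+ s.+1 * rbinom x s.+1)) < y ^+ r.+1.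
  rewrite -(ltr_pM2l r2).
  have -> : r.*2%:R * y ^+ r.+1 = r.*2%:R * y * y ^+ r by rewrite exprS mulrA.
  have hK' : K%:R * (rbinom x s.+1 * (y - x)) * y ^+ r < r.*2%:R * y * y ^+ r.
    by rewrite ltr_pM2r.
  apply: le_lt_trans hK'; rewrite Kdef 3!natrM !natrX.
  by rewrite le_eqVlt; apply/orP; left; apply/eqP; ring.
rewrite -(ltr_pM2l rf) -(ltr_pM2l p2) mulrA.
apply: (lt_le_trans h4); rewrite mulrA -mulrA.
apply: (@le_trans _ _ (2 ^+ r.+1 * (y / 2) ^+ r.+1)); last by rewrite ler_pM2l.
by rewrite -exprMn (_ : 2 * (y / 2) = y) //; lra.
Qed.

(** Oresme's argument: after [m] terms, the next X+m+1 terms are each at least 1 / (2(X+m+1)) and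
    add 1/2. The choice of [m] precedes [R], so the final threshold does not depend on the field. *)
Lemma harmonic_unbounded (X L : nat) : exists m : nat, forall R : realType,
  L%:R <= \sum_(i < m) (X + i).+1%:R^-1 :> R.
Proof.
suff half (l : nat) : exists m : nat, forall R : realType,
    l%:R / 2 <= \sum_(i < m) (X + i).+1%:R^-1 :> R.
  have [m hm] := half L.*2; exists m => R; apply: le_trans (hm R).
  by rewrite -muln2 natrM mulfK ?pnatr_eq0.
elim: l => [|l [m IH]]; first by exists 0%N => R; rewrite big_ord0 mul0r.
exists (m + (X + m).+1)%N => R; rewrite big_split_ord /= -natr1 mulrDl lerD ?IH //.
have h (i : 'I_(X + m).+1) : true ->
    ((X + m).+1.*2)%:R^-1 <= (X + (m + i)).+1%:R^-1 :> R.
  move=> _; rewrite lef_pV2 ?posrE ?ltr0n ?double_gt0 // ler_nat.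
  by rewrite -addnn addnA addSn ltnS leq_add2l ltnW.
apply: le_trans (ler_sum _ h); rewrite sumr_const card_ord -[leRHS]mulr_natl.
by rewrite -muln2 natrM invfM mulrA mulfV ?pnatr_eq0.
Qed.

(** * Links, deletions and ranks *)

(** The ground type stays [T] here and in [link], so inclusion matrices of the same order share
    their column index. *)
Definition del (T : finType) (v : T) (E : {set {set T}}) : {set {set T}} :=
  [set e in E | v \notin e].

Definition link (T : finType) (v : T) (E : {set {set T}}) : {set {set T}} :=
  [set e :\ v | e in [set e in E | v \in e]].

Lemma uniform_del (T : finType) (r : nat) (v : T) (E : {set {set T}}) :
  uniform r E -> uniform r (del v E).
Proof. by move=> uE e; rewrite inE => /andP[/uE]. Qed.

Lemma uniform_link (T : finType) (r : nat) (v : T) (E : {set {set T}}) :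
  uniform r.+1 E -> uniform r (link v E).
Proof.
move=> uE _ /imsetP[e + ->]; rewrite inE => /andP[/uE + ve].
by rewrite (cardsD1 v) ve => -[].
Qed.

Lemma card_link (T : finType) (v : T) (E : {set {set T}}) :
  #|link v E| = #|[set e in E | v \in e]|.
Proof.
apply: card_in_imset => e f; rewrite !inE => /andP[_ ve] /andP[_ vf] ef.
by rewrite -(setD1K ve) ef setD1K.
Qed.

Lemma card_link_del (T : finType) (v : T) (E : {set {set T}}) :
  #|E| = (#|link v E| + #|del v E|)%N.
Proof.
rewrite card_link -(cardsID [set e : {set T} | v \in e] E); congr addn.
  by apply: eq_card => e; rewrite !inE.
by apply: eq_card => e; rewrite !inE andbC.
Qed.

Lemma exists_subset (T : finType) (A : {set T}) (k : nat) :
  (k <= #|A|)%N -> exists2 B : {set T}, B \subset A & #|B| = k.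
Proof.
move=> hk; have : (0 < #|[set B : {set T} | B \subset A & #|B| == k]|)%N.
  by rewrite cards_draws bin_gt0.
by case/card_gt0P => B; rewrite inE => /andP[BA /eqP]; exists B.
Qed.

Lemma card_subsets (T : finType) (k : nat) (X : {set T}) :
  #|subsets_of_card k X| = 'C(#|X|, k).
Proof. by rewrite -cards_draws; apply: eq_card => e; rewrite !inE. Qed.

Lemma mem_subsetsT (T : finType) (k : nat) (S : {set T}) :
  (S \in subsets_of_card k [set: T]) = (#|S| == k).
Proof. by rewrite inE subsetT. Qed.

Lemma enum_val_surj (T : finType) (A : {set T}) (x : T) :
  x \in A -> exists i : 'I_#|A|, enum_val i = x.
Proof. by move=> xA; exists (enum_rank_in xA x); rewrite enum_rankK_in. Qed.

Lemma rank_gt0 (T : finType) (s : nat) (E : {set {set T}}) (e : {set T}) :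
  e \in E -> (s <= #|e|)%N -> (0 < \rank (inclusion_mx s E))%N.
Proof.
move=> eE /exists_subset[S Se hS]; rewrite lt0n mxrank_eq0.
have [i hi] := enum_val_surj eE.
have [j hj] : exists j : 'I_#|subsets_of_card s [set: T]|, enum_val j = S.
  by apply: enum_val_surj; rewrite mem_subsetsT hS.
apply/negP => /eqP /matrixP /(_ i j); rewrite !mxE hi hj Se => /eqP.
by rewrite oner_eq0.
Qed.

(** The columns indexed by edges, selected by [B], form an identity matrix: an s-set contained in an
    s-edge equals it. *)
Lemma rank_diag (T : finType) (s : nat) (E : {set {set T}}) :
  uniform s E -> (#|E| <= \rank (inclusion_mx s E))%N.
Proof.
move=> uE.
pose B : 'M[rat]_(#|subsets_of_card s [set: T]|, #|E|) :=
  \matrix_(j, i) ((enum_val j : {set T}) == enum_val i)%:R.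
suff h : inclusion_mx s E *m B = 1%:M.
  by rewrite -[X in (X <= _)%N](@mxrank1 rat) -h mxrankM_maxl.
apply/matrixP => i k; rewrite !mxE.
have [j hj] : exists j : 'I_#|subsets_of_card s [set: T]|, enum_val j = enum_val k.
  by apply: enum_val_surj; rewrite mem_subsetsT uE // enum_valP.
rewrite (bigD1 j) //= !mxE hj eqxx mulr1 big1 ?addr0 => [|l lj].
  congr (GRing.natmul _ (nat_of_bool _)); apply/idP/eqP => [h|->//].
  apply: enum_val_inj; apply/esym/eqP.
  by rewrite eqEcard h (uE _ (enum_valP i)) (uE _ (enum_valP k)) leqnn.
rewrite !mxE -hj (_ : (_ == _) = false) ?mulr0 //.
by apply: contraNF lj => /eqP /enum_val_inj ->.
Qed.

(** Multiplying by [P] selects the columns whose set contains [v]. Rows of edges through [v] become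
    rows of the link's matrix, and rows of the other edges are killed. The two ranks thus bound the
    image and the kernel part of the row space under [P]. *)
Lemma rank_link_del (T : finType) (s : nat) (v : T) (E : {set {set T}}) :
  (\rank (inclusion_mx s (link v E)) + \rank (inclusion_mx s.+1 (del v E))
     <= \rank (inclusion_mx s.+1 E))%N.
Proof.
pose P : 'M[rat]_(#|subsets_of_card s.+1 [set: T]|, #|subsets_of_card s [set: T]|) :=
  \matrix_(j, k) ((v \notin (enum_val k : {set T})) &&
                  ((enum_val j : {set T}) == v |: enum_val k))%:R.
have rowP_ (F : {set {set T}}) (i : 'I_#|F|) (k : 'I_#|subsets_of_card s [set: T]|) :
    (row i (inclusion_mx s.+1 F) *m P) 0 k =
    ((v \in (enum_val i : {set T})) &&
     ((enum_val k : {set T}) \subset enum_val i :\ v))%:R.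
  rewrite !mxE.
  have hk : #|enum_val k| = s.
    by have := enum_valP k; rewrite mem_subsetsT => /eqP.
  case: (boolP (v \in (enum_val k : {set T}))) => vk.
    rewrite big1 => [|j _]; last by rewrite !mxE vk mulr0.
    by rewrite subsetD1 vk !andbF.
  have [j hj] : exists j : 'I_#|subsets_of_card s.+1 [set: T]|,
      enum_val j = v |: enum_val k.
    by apply: enum_val_surj; rewrite mem_subsetsT cardsU1 vk hk.
  rewrite (bigD1 j) //= !mxE hj eqxx vk mulr1 big1 ?addr0 => [|l lj].
    by rewrite subUset sub1set subsetD1 vk andbT.
  rewrite !mxE -hj (_ : (_ == _) = false) ?andbF ?mulr0 //.
  by apply: contraNF lj => /eqP /enum_val_inj ->.
rewrite -(mxrank_mul_ker (inclusion_mx s.+1 E) P); apply: leq_add.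
  apply: mxrankS; apply/row_subP => i.
  have /imsetP[e] := enum_valP i; rewrite inE => /andP[eE ve] he.
  have [l hl] := enum_val_surj eE.
  have -> : row i (inclusion_mx s (link v E)) =
            row l (inclusion_mx s.+1 E *m P).
    by apply/rowP => k; rewrite row_mul rowP_ !mxE hl ve he.
  exact: row_sub.
apply: mxrankS; rewrite sub_capmx; apply/andP; split; apply/row_subP => i.
  have := enum_valP i; rewrite inE => /andP[eE ve].
  have [l hl] := enum_val_surj eE.
  have -> : row i (inclusion_mx s.+1 (del v E)) = row l (inclusion_mx s.+1 E).
    by apply/rowP => k; rewrite !mxE hl.
  exact: row_sub.
apply/sub_kermxP/rowP => k; rewrite rowP_ mxE.
by have := enum_valP i; rewrite inE => /andP[_ /negbTE ->].
Qed.

(** * Gottlieb's theorem and the rank of nearly complete hypergraphs *)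

Lemma sum_subsets_setU1 (T : finType) (a : T) (f : {set T}) (s : nat)
    (g : {set T} -> rat) : a \notin f ->
  \sum_(S in subsets_of_card s.+1 (a |: f)) g S =
  \sum_(S in subsets_of_card s f) g (a |: S) +
  \sum_(S in subsets_of_card s.+1 f) g S.
Proof.
move=> af; rewrite (bigID (fun S : {set T} => a \in S)) /=; congr (_ + _).
  rewrite (reindex_onto (fun S : {set T} => a |: S) (fun S => S :\ a)) /=; last first.
    by move=> S /andP[_ aS]; rewrite setD1K.
  apply: eq_bigl => S; rewrite !inE eqxx andbT /=.
  apply/idP/idP => [/andP[/andP[aSf /eqP cS] /eqP eS]|/andP[Sf /eqP cS]].
    have aS : a \notin S by rewrite -eS !inE eqxx.
    move: cS; rewrite cardsU1 aS add1n => -[->]; rewrite eqxx andbT.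
    apply/subsetP => y yS; have := subsetP aSf y; rewrite !inE yS orbT => /(_ isT).
    by case/orP => // /eqP ya; rewrite -ya yS in aS.
  have aS : a \notin S by apply: contra af; apply: (subsetP Sf).
  by rewrite setUS // cardsU1 aS add1n cS eqxx setU1K // eqxx.
apply: eq_bigl => S; rewrite !inE.
apply/idP/idP => [/andP[/andP[aSf ->] aS]|/andP[Sf ->]].
  rewrite andbT; apply/subsetP => y yS; have := subsetP aSf y yS; rewrite !inE.
  by case/orP => // /eqP ya; rewrite -ya yS in aS.
rewrite andbT (contra (subsetP Sf a)) // andbT.
by apply: subset_trans Sf _; apply: subsetUr.
Qed.

(** Induction on [s]: exchanging [a] for [b] in a set does not change [g], because the difference
    satisfies the hypothesis with both orders lowered by one on [W] without [a] and [b]. So [g] is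
    constant, and a positive multiple of the constant is zero. *)
Lemma gottlieb (T : finType) (s r : nat) (W : {set T}) (g : {set T} -> rat) :
  (s <= r)%N -> (r + s <= #|W|)%N ->
  (forall e, e \in subsets_of_card r W -> \sum_(S in subsets_of_card s e) g S = 0) ->
  forall S, S \in subsets_of_card s W -> g S = 0.
Proof.
elim: s r W g => [|s IH] r W g sr rW hg S hS.
  have [e eW he] := @exists_subset _ W r (leq_trans (leq_addr _ _) rW).
  have := hg e; rewrite inE eW he eqxx => /(_ isT).
  rewrite (big_pred1 set0) => [g0|A].
    by move: hS; rewrite inE cards_eq0 => /andP[_ /eqP ->].
  rewrite inE cards_eq0 /=; apply/andP/eqP => [[_ /eqP]//|->].
  by rewrite sub0set.
case: r sr rW hg => // r sr rW hg.
(* In the sums over subsets of [a |: f] and of [b |: f], the sets inside [f] cancel. *)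
have swap (a b : T) (A : {set T}) : a \in W -> b \in W -> a != b ->
    A \in subsets_of_card s (W :\ a :\ b) -> g (a |: A) = g (b |: A).
  move=> aW bW ab hA; apply/eqP; rewrite -subr_eq0; apply/eqP.
  apply: (IH r (W :\ a :\ b) (fun A => g (a |: A) - g (b |: A))) hA => //.
    move: rW; rewrite (cardsD1 a) aW (cardsD1 b) !inE bW eq_sym ab /=.
    by rewrite !add1n addSn addnS !ltnS.
  move=> f; rewrite inE => /andP[fW /eqP cf].
  have af : a \notin f by apply/negP => /(subsetP fW); rewrite !inE eqxx andbF.
  have bf : b \notin f by apply/negP => /(subsetP fW); rewrite !inE eqxx.
  have fW' : f \subset W by apply: subset_trans fW _; rewrite subDset subsetU // subsetDl orbT.
  have ha := hg (a |: f); have hb := hg (b |: f).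
  rewrite inE subUset sub1set aW fW' cardsU1 af cf eqxx sum_subsets_setU1 // in ha.
  rewrite inE subUset sub1set bW fW' cardsU1 bf cf eqxx sum_subsets_setU1 // in hb.
  rewrite sumrB; apply/eqP; rewrite subr_eq0.
  by rewrite -(inj_eq (addIr (\sum_(S in subsets_of_card s.+1 f) g S))) ha ?hb.
have const (m : nat) (A : {set T}) : A \in subsets_of_card s.+1 W ->
    #|A :\: S| = m -> g A = g S.
  elim: m A => [|m IHm] A hA.
    move/eqP; rewrite cards_eq0 setD_eq0 => AS; congr g; apply/eqP.
    move: hA hS; rewrite !inE => /andP[_ /eqP cA] /andP[_ /eqP cS].
    by rewrite eqEcard AS cA cS leqnn.
  move=> cD.
  have [a] : exists a, a \in A :\: S by apply/card_gt0P; rewrite cD.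
  rewrite inE => /andP[aS aA].
  move: (hA) (hS); rewrite !inE => /andP[AW /eqP cA] /andP[SW /eqP cS].
  have [b] : exists b, b \in S :\: A.
    apply/card_gt0P; rewrite cardsD setIC -cS in cA *.
    by move: (cD); rewrite cardsD cA setIC => ->.
  rewrite inE => /andP[bA bS].
  have ab : a != b by apply: contraNneq aS => ->.
  have cA' : #|A :\ a| = s by move: cA; rewrite (cardsD1 a) aA => -[].
  have bA' : b \notin A :\ a by rewrite !inE negb_and bA orbT.
  rewrite -(setD1K aA) (swap a b (A :\ a)) //; last 3 first.
  - exact: (subsetP AW).
  - exact: (subsetP SW).
  - rewrite inE cA' eqxx andbT; apply/subsetP => y; rewrite !inE => /andP[ya yA].
    by rewrite ya (subsetP AW) // !andbT; apply: contraNneq bA => <-.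
  apply: IHm.
    rewrite inE subUset sub1set (subsetP SW) // cardsU1 bA' cA' eqxx andbT /=.
    by apply: subset_trans AW; apply: subsetDl.
  have -> : (b |: (A :\ a)) :\: S = (A :\: S) :\ a.
    apply/setP => y; rewrite !inE; case: (y =P b) => [->|_] /=; first by rewrite bS andbF.
    by rewrite andbCA.
  by move: cD; rewrite (cardsD1 a) inE aS aA => -[].
have [e eW he] := @exists_subset _ W r.+1 (leq_trans (leq_addr _ _) rW).
have := hg e; rewrite inE eW he eqxx => /(_ isT).
rewrite (eq_bigr (fun=> g S)) => [|A]; last first.
  rewrite inE => /andP[Ae cA]; apply: const (erefl _).
  by rewrite inE cA (subset_trans Ae).
rewrite sumr_const card_subsets he => /eqP; rewrite mulrn_eq0 => /orP[|/eqP //].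
by rewrite eqn0Ngt bin_gt0 sr.
Qed.

Lemma card_bigcup_le (T U : finType) (D : {set T}) (F : T -> {set U}) (n : nat) :
  (forall e, e \in D -> (#|F e| <= n)%N) -> (#|\bigcup_(e in D) F e| <= #|D| * n)%N.
Proof.
move=> hF; apply: (@leq_trans (\sum_(e in D) #|F e|)).
  elim/big_rec2: _ => [|e A m _ IH]; first by rewrite cards0.
  by apply: leq_trans (leq_card_setU _ _) _; rewrite leq_add2l.
by rewrite -sum_nat_const; apply: leq_sum.
Qed.

(** Union bound over the r-sets [R] disjoint from [S0], with [W] the union of [S0] and [R]. A
    missing edge [e] spoils [R] only if [R] contains a fixed (r-s)-subset [B] of [e :\: S0]; the
    rest of [R] is then an s-set. *)
Lemma exists_complete (T : finType) (s r : nat) (V S0 : {set T}) (E : {set {set T}}) :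
  (s <= r)%N -> E \subset subsets_of_card r V -> S0 \in subsets_of_card s V ->
  (('C(#|V|, r) - #|E|) * 'C(#|V|, s) < 'C(#|V| - s, r))%N ->
  exists W : {set T}, [/\ S0 \subset W, #|W| = (r + s)%N &
    subsets_of_card r W \subset E].
Proof.
move=> sr EV; rewrite inE => /andP[S0V /eqP cS0] hC.
pose Rs := subsets_of_card r (V :\: S0).
pose F (e : {set T}) := [set R in Rs | e \subset S0 :|: R].
pose D := subsets_of_card r V :\: E.
have cD : #|D| = ('C(#|V|, r) - #|E|)%N.
  by rewrite cardsD (setIidPr EV) card_subsets.
have hF e : e \in D -> (#|F e| <= 'C(#|V|, s))%N.
  rewrite !inE => /and3P[_ eV /eqP ce].
  have [B Be cB] : exists2 B : {set T}, B \subset e :\: S0 & #|B| = (r - s)%N.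
    apply: exists_subset; rewrite cardsD ce leq_sub2l // -cS0.
    by apply: subset_leq_card; apply: subsetIr.
  have BR R : R \in F e -> B \subset R.
    rewrite inE => /andP[_ eR]; apply: subset_trans Be _.
    by rewrite subDset.
  rewrite -card_subsets -(card_in_imset (f := fun R => R :\: B)); last first.
    move=> R R' /BR BR1 /BR BR2 h.
    by rewrite -(setID R B) -(setID R' B) (setIidPr BR1) (setIidPr BR2) h.
  apply: subset_leq_card; apply/subsetP => _ /imsetP[R RF ->].
  have BR1 := BR _ RF; move: RF; rewrite !inE => /andP[/andP[RV /eqP cR] _].
  rewrite cardsD (setIidPr BR1) cR cB subKn // eqxx andbT.
  apply: subset_trans (subsetDl _ _) (subset_trans RV (subsetDl _ _)).
have cRs : #|Rs| = 'C(#|V| - s, r).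
  by rewrite card_subsets cardsD (setIidPr S0V) cS0.
have /subsetPn[R RR RF] : ~~ (Rs \subset \bigcup_(e in D) F e).
  apply/negP => /subset_leq_card; rewrite cRs leqNgt => /negP; apply.
  by apply: leq_ltn_trans hC; rewrite -cD; apply: card_bigcup_le.
move: (RR); rewrite inE => /andP[RV /eqP cR].
exists (S0 :|: R); split; first exact: subsetUl.
  rewrite cardsU cS0 cR (_ : S0 :&: R = set0) ?cards0 ?subn0 1?addnC //.
  apply/setP => y; rewrite !inE; apply/andP => -[yS /(subsetP RV)].
  by rewrite inE yS.
apply/subsetP => e; rewrite inE => /andP[eR /eqP ce].
apply: contraNT RF => eE; apply/bigcupP; exists e; last by rewrite inE RR eR.
rewrite !inE eE ce eqxx andbT /=; apply: subset_trans eR _.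
by rewrite subUset S0V (subset_trans RV) // subsetDl.
Qed.

(** The columns indexed by s-subsets of [V] are independent: each such subset lies in a set of r+s
    vertices on which [E] is complete, where [gottlieb] makes the coefficient vanish. *)
Lemma rank_full (T : finType) (s r : nat) (V : {set T}) (E : {set {set T}}) :
  (s <= r)%N -> E \subset subsets_of_card r V ->
  (('C(#|V|, r) - #|E|) * 'C(#|V|, s) < 'C(#|V| - s, r))%N ->
  ('C(#|V|, s) <= \rank (inclusion_mx s E))%N.
Proof.
move=> sr EV hC.
pose Q : 'M[rat]_(#|subsets_of_card s [set: T]|, #|subsets_of_card s V|) :=
  \matrix_(j, k) ((enum_val j : {set T}) == enum_val k)%:R.
have AQ i k : (inclusion_mx s E *m Q) i k =
    ((enum_val k : {set T}) \subset enum_val i)%:R.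
  rewrite !mxE.
  have [j hj] : exists j : 'I_#|subsets_of_card s [set: T]|, enum_val j = enum_val k.
    apply: enum_val_surj; rewrite mem_subsetsT.
    by have := enum_valP k; rewrite inE => /andP[].
  rewrite (bigD1 j) //= !mxE hj eqxx mulr1 big1 ?addr0 // => l lj.
  rewrite !mxE -hj (_ : (_ == _) = false) ?mulr0 //.
  by apply: contraNF lj => /eqP /enum_val_inj ->.
apply: leq_trans (mxrankM_maxl _ Q); rewrite -mxrank_tr -card_subsets.
suff : row_free (inclusion_mx s E *m Q)^T by rewrite /row_free => /eqP ->.
apply: inj_row_free => v hv.
(* The coefficients [v] viewed as a function of sets, extended by 0. *)
pose g (S : {set T}) : rat := \sum_k ((enum_val k == S)%:R * v 0 k).
have gE k : g (enum_val k) = v 0 k.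
  rewrite /g (bigD1 k) //= eqxx mul1r big1 ?addr0 // => l lk.
  rewrite (_ : (_ == _) = false) ?mul0r //.
  by apply: contraNF lk => /eqP /enum_val_inj ->.
apply/rowP => k; rewrite mxE -gE.
have [W [SW cW WE]] := exists_complete sr EV (enum_valP k) hC.
apply: (gottlieb sr (W := W)); first by rewrite cW.
  move=> e /(subsetP WE) eE; have [i hi] := enum_val_surj eE.
  have := congr1 (fun M : 'rV_ _ => M 0 i) hv; rewrite !mxE => hi0; apply: etrans hi0.
  rewrite /g exchange_big; apply: eq_bigr => l _ /=.
  rewrite mxE AQ -mulr_suml mulrC; congr (_ * _); rewrite hi.
  have := enum_valP l; rewrite inE => /andP[_ /eqP cl].
  case: (boolP (enum_val l \subset e)) => le.
    rewrite (bigD1 (enum_val l)) ?inE ?le ?cl //= eqxx big1 ?addr0 // => S /andP[_ Sl].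
    by rewrite eq_sym (negbTE Sl).
  rewrite big1 // => S; rewrite inE => /andP[Se _].
  by rewrite (_ : (_ == _) = false) //; apply: contraNF le => /eqP ->.
by have := enum_valP k; rewrite !inE SW => /andP[_ ->].
Qed.

(** * Non-isolated vertices and degrees *)

Lemma sub_subsets_cover (T : finType) (r : nat) (E : {set {set T}}) :
  uniform r E -> E \subset subsets_of_card r (cover E).
Proof.
move=> uE; apply/subsetP => e eE; rewrite inE uE // eqxx andbT.
exact: bigcup_sup.
Qed.

Lemma sum_degree (T : finType) (r : nat) (E : {set {set T}}) :
  uniform r E -> (\sum_(v in cover E) #|link v E| = r * #|E|)%N.
Proof.
move=> uE.
rewrite (eq_bigr (fun v => \sum_(e in E | v \in e) 1)%N) => [|v _]; last first.
  by rewrite card_link -sum1_card; apply: eq_bigl => e; rewrite inE.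
rewrite (exchange_big_dep (fun e => e \in E)) /=; last by move=> v e _ /andP[].
rewrite mulnC -sum_nat_const; apply: eq_bigr => e eE.
rewrite -(uE e eE) -sum1_card; apply: eq_bigl => v; rewrite eE /= andbC.
case: (boolP (v \in e)) => //= ve; apply/bigcupP; by exists e.
Qed.

(** The minimum over non-isolated vertices is positive and at most the average degree. *)
Lemma exists_low_degree (T : finType) (r : nat) (E : {set {set T}}) :
  uniform r.+1 E -> (0 < #|E|)%N ->
  exists v, (0 < #|link v E|)%N /\ (#|link v E| * #|cover E| <= r.+1 * #|E|)%N.
Proof.
move=> uE /card_gt0P[e eE].
have [v0 v0e] : exists v0, v0 \in e by apply/card_gt0P; rewrite uE.
have v0c : v0 \in cover E by apply/bigcupP; exists e.
have [v vc vmin] := arg_minnP (fun v => #|link v E|) v0c.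
exists v; split.
  case/bigcupP: vc => f fE vf; apply/card_gt0P; exists (f :\ v).
  by apply/imsetP; exists f; rewrite ?inE ?fE.
rewrite -(sum_degree uE) mulnC -sum_nat_const; exact: leq_sum.
Qed.

(** * Descent on the deficit *)

Definition rank_bound (r s n : nat) : Prop :=
  forall (R : realType) (T : finType) (E : {set {set T}}) (x : R),
    uniform r E -> r%:R <= x -> #|E|%:R = rbinom x r -> (n <= #|E|)%N ->
    rbinom x s <= (\rank (inclusion_mx s E))%:R.

Lemma le_card_cover (R : realType) (T : finType) (r : nat) (E : {set {set T}})
    (x : R) : uniform r.+1 E -> r.+1%:R <= x -> #|E|%:R = rbinom x r.+1 ->
  x <= #|cover E|%:R.
Proof.
move=> uE rx cE; rewrite leNgt; apply/negP => Nx.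
have : (0 < #|E|)%N by rewrite -(ltr0n R) cE rbinom_gt0.
case/card_gt0P => e eE.
have rN : (r.+1 <= #|cover E|)%N.
  by rewrite -(uE e eE); apply: subset_leq_card; exact: bigcup_sup.
have : (#|E| <= 'C(#|cover E|, r.+1))%N.
  by rewrite -card_subsets; apply: subset_leq_card; apply: sub_subsets_cover.
rewrite -(ler_nat R) cE -rbinom_nat leNgt => /negP; apply.
apply: rbinom_lt => //; apply: (@le_trans _ _ #|cover E|%:R); first by rewrite ler_nat.
by rewrite lerDl.
Qed.

(** Call the excess of the link's rank over b_(s+1)(x) - b_(s+1)(z) the margin. A margin of at least
    1/(Kx) gives the first alternative; a smaller one forces [d] close to b_r(x-1), hence N close to
    [x]. *)
Lemma delete_or_full (r s n1 : nat) : (s < r)%N -> rank_bound r s n1 ->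
  exists K X : nat, [/\ (0 < K)%N, (r.+1 <= X)%N &
    forall (R : realType) (T : finType) (E : {set {set T}}) (x : R),
    uniform r.+1 E -> X%:R <= x -> #|E|%:R = rbinom x r.+1 ->
    (exists (v : T) (z : R), [/\ x - 1 <= z <= x, #|del v E|%:R = rbinom z r.+1,
        (#|del v E| < #|E|)%N &
        rbinom x s.+1 - (\rank (inclusion_mx s.+1 E))%:R + (K%:R * x)^-1 <=
        rbinom z s.+1 - (\rank (inclusion_mx s.+1 (del v E)))%:R]) \/
    ('C(#|cover E|, s.+1) <= \rank (inclusion_mx s.+1 E))%N].
Proof.
move=> sr bnd.
(* [K] is what [missing_bound] needs; [X] makes a vertex of degree less than [n1],
   to which [bnd] does not apply, cost at most 1/2 in [rbinom x s.+1]. *)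
pose K := (4 ^ s.+1 * (r.*2 * (2 ^ r.+1 * r.+1`!)))%N.
pose X := ((r + s + 2).*2 + (n1 * r`!).*2)%N.
have r0 : (0 < r)%N by apply: leq_ltn_trans sr.
have K0 : (0 < K)%N by rewrite !muln_gt0 !expn_gt0 double_gt0 r0 fact_gt0.
exists K, X; split=> //.
  by rewrite /X -!addnn; lia.
move=> R T E x uE Xx cE.
have [hx0 hx1] : (r + s + 2).*2%:R <= x /\ (n1 * r`!).*2%:R + (r + s + 2).*2%:R <= x.
  split; apply: le_trans Xx; rewrite -?natrD ler_nat /X ?leq_addr //.
  by rewrite addnC.
have hx2 : (r%:R + s%:R + 2) * 2 <= x.
  by apply: le_trans hx0; rewrite -muln2 natrM !natrD.
have hx3 : (n1 * r`!).*2%:R + (r%:R + s%:R + 2) * 2 <= x.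
  by apply: le_trans hx1; rewrite lerD2l -muln2 natrM !natrD.
have rR0 : 1 <= r%:R :> R by rewrite ler1n.
have sR0 : 0 <= s%:R :> R by apply: ler0n.
have srR : s%:R + 1 <= r%:R :> R by rewrite natr1 ler_nat.
have KR : 1 <= K%:R :> R by rewrite ler1n.
have x0 : 0 < x by lra.
have Kx : x <= K%:R * x by rewrite -{1}[x]mul1r ler_pM2r.
have rx : r.+1%:R <= x by rewrite -natr1; lra.
have xN := le_card_cover uE rx cE.
have E0 : (0 < #|E|)%N by rewrite -(ltr0n R) cE rbinom_gt0.
have [v [d0 hd]] := exists_low_degree uE E0.
set N := #|cover E| in xN hd *; set d := #|link v E| in d0 hd *.
pose w := x - 1.
have Wr : 0 < rbinom w r by apply: rbinom_gt0; rewrite /w; lra.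
have Ws : 0 < rbinom w s by apply: rbinom_gt0; rewrite /w; lra.
have dR0 : 1 <= d%:R :> R by rewrite ler1n.
have dN : d%:R * N%:R <= x * rbinom w r.
  by rewrite -rbinom_absorb -cE -!natrM ler_nat.
have dW : d%:R <= rbinom w r.
  rewrite -(ler_pM2l x0); apply: le_trans dN; rewrite mulrC.
  exact: ler_wpM2l.
(* That [z] can be taken at least [x - 1] is Pascal's rule together with d <= b_r(x-1). *)
have [z /andP[xz zx] hz] : exists2 z, x - 1 <= z <= x & rbinom z r.+1 = rbinom x r.+1 - d%:R.
  apply: rbinom_ivt; first lra.
  by rewrite {1}[rbinom x _]rbinom_pascal -/w; apply/andP; split; lra.
have cdel : #|del v E|%:R = rbinom z r.+1.
  by rewrite hz -cE (card_link_del v E) natrD addrC addKr.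
have slope := rbinom_slope (ltnW sr) rx xz zx.
rewrite hz subKr -/w in slope.
have rk := rank_link_del s v E; rewrite -(ler_nat R) natrD in rk.
set rho := \rank (inclusion_mx s (link v E)) in rk.
have step : (K%:R * x)^-1 <= rho%:R - (rbinom x s.+1 - rbinom z s.+1) ->
    rbinom x s.+1 - (\rank (inclusion_mx s.+1 E))%:R + (K%:R * x)^-1 <=
    rbinom z s.+1 - (\rank (inclusion_mx s.+1 (del v E)))%:R by lra.
have ltdel : (#|del v E| < #|E|)%N by rewrite (card_link_del v E) -{1}[#|_|]add0n ltn_add2r.
have Kx2 : (K%:R * x)^-1 <= 1 / 2.
  by rewrite div1r lef_pV2 ?posrE; lra.
have uL := @uniform_link _ r v E uE.
(* For [d < n1] the link still has rank at least 1, while the loss is at most 1/2. *)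
have [dn | nd] := ltnP d n1.
  left; exists v, z; split=> //; first by rewrite xz.
  apply: step; apply: le_trans Kx2 _.
  have rho1 : 1 <= rho%:R :> R.
    case/card_gt0P: d0 => f fL; rewrite ler1n.
    by apply: (rank_gt0 fL); rewrite (uL f fL) ltnW.
  have h : (n1 * r`!).*2%:R * rbinom w s <= r`!%:R * rbinom w r.
    apply: rbinom_growth => //.
      by rewrite ler1n double_gt0 muln_gt0 fact_gt0 (leq_ltn_trans _ dn).
    by rewrite /w; lra.
  have e : (n1 * r`!).*2%:R = r`!%:R * (n1%:R * 2) :> R.
    by rewrite -muln2 2!natrM; ring.
  rewrite e -mulrA ler_pM2l in h; last by rewrite ltr0n fact_gt0.
  have h2 : d%:R * rbinom w s <= n1%:R * rbinom w s by rewrite ler_pM2r // ler_nat ltnW.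
  have : rbinom x s.+1 - rbinom z s.+1 <= 1 / 2.
    by rewrite -(ler_pM2r Wr); lra.
  by lra.
have [u /andP[ru uw] hu] : exists2 u, r%:R <= u <= w & rbinom u r = d%:R.
  apply: rbinom_ivt; first by rewrite /w; lra.
  by rewrite rbinom_nat binn ler1n d0.
have rhoU : rbinom u s <= rho%:R by apply: bnd => //.
have U1 : 1 <= rbinom u s by apply: rbinom_ge1; lra.
have gain : rbinom u s * (rbinom w r - d%:R) <=
    r%:R * (rbinom u s * rbinom w r - rbinom w s * d%:R).
  move: ru hu uw sr; case: (r) r0 => // r' _ ru hu uw; rewrite ltnS => sr.
  by rewrite -hu; apply: rbinom_gain.
have [big | small] := leP (K%:R * x)^-1 (rho%:R - (rbinom x s.+1 - rbinom z s.+1)).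
  by left; exists v, z; split=> //; [rewrite xz | exact: step].
right; apply: rank_full (sub_subsets_cover uE) _; first by rewrite ltnS ltnW.
have NN : 'C(N, r.+1)%:R = rbinom (N%:R : R) r.+1 by rewrite rbinom_nat.
have N2 : (s.+1 <= N)%N.
  by rewrite -(ler_nat R); apply: le_trans xN; rewrite -natr1; lra.
have EN : (#|E| <= 'C(N, r.+1))%N.
  by rewrite -card_subsets; apply: subset_leq_card; apply: sub_subsets_cover.
rewrite -(ltr_nat R) natrM natrB // -!rbinom_nat natrB // cE.
have Kx0 : 0 < K%:R * x by lra.
have h1 : K%:R * x * (rbinom u s * (rbinom w r - d%:R)) < r%:R * rbinom w r.
  have h : K%:R * x * (rbinom u s * rbinom w r - rbinom w s * d%:R) < rbinom w r.
    rewrite -ltr_pdivlMl //.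
    pose g := rho%:R - (rbinom x s.+1 - rbinom z s.+1).
    apply: (@le_lt_trans _ _ (g * rbinom w r)); last by rewrite ltr_pM2r.
    rewrite /g.
    have : rbinom u s * rbinom w r <= rho%:R * rbinom w r by rewrite ler_pM2r.
    by lra.
  apply: (@le_lt_trans _ _ (K%:R * x * (r%:R * (rbinom u s * rbinom w r - rbinom w s * d%:R)))).
    by rewrite ler_pM2l.
  by rewrite mulrCA ltr_pM2l //; lra.
have Wd : 0 <= rbinom w r - d%:R by lra.
(* Bootstrapping: b_s(u) >= 1 and Kx >= 2r give d >= b_r(w)/2, so b_s(u) >= b_s(w)/2, which sharpens
   [h1] to [h4]. *)
have h2 : rbinom w r - d%:R <= rbinom w r / 2.
  have h : (r%:R * 2) * (rbinom u s * (rbinom w r - d%:R)) <= r%:R * rbinom w r.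
    apply: ltW; apply: le_lt_trans h1; apply: ler_wpM2r; last lra.
    by rewrite mulr_ge0 //; lra.
  have h' : rbinom w r - d%:R <= rbinom u s * (rbinom w r - d%:R).
    by rewrite -{1}[rbinom w r - _]mul1r ler_wpM2r.
  rewrite -mulrA ler_pM2l in h; lra.
have h3 : rbinom w s / 2 <= rbinom u s.
  have h : rbinom w s * d%:R <= rbinom u s * rbinom w r.
    rewrite -subr_ge0 -(pmulr_rge0 _ (_ : 0 < r%:R)); last lra.
    by apply: le_trans gain; rewrite mulr_ge0 //; lra.
  rewrite -(ler_pM2r Wr); apply: le_trans h; rewrite -mulrA ler_pM2l //; lra.
have h4 : K%:R * x * (rbinom w s * (rbinom w r - d%:R)) < r.*2%:R * rbinom w r.
  rewrite -muln2 natrM.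
  have : K%:R * x * (rbinom w s / 2 * (rbinom w r - d%:R)) < r%:R * rbinom w r.
    by apply: le_lt_trans h1; rewrite ler_pM2l // ler_wpM2r.
  by lra.
have N0 : 0 < N%:R :> R by lra.
(* A rearrangement of [dN]: the degree gap controls N - x. *)
have h5 : (N%:R - x) * rbinom w r <= N%:R * (rbinom w r - d%:R) by lra.
have yx : N%:R <= 2 * x.
  have : (N%:R - x) * rbinom w r <= (N%:R / 2) * rbinom w r.
    apply: le_trans h5 _; rewrite -mulrA ler_pM2l //; lra.
  by rewrite ler_pM2r //; lra.
apply: (@missing_bound R x N%:R r s K) => //.
have h6 : K%:R * (x * rbinom w s * (N%:R - x)) < r.*2%:R * N%:R.
  rewrite -(ltr_pM2r Wr).
  have : K%:R * x * rbinom w s * ((N%:R - x) * rbinom w r) <=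
         K%:R * x * rbinom w s * (N%:R * (rbinom w r - d%:R)).
    by rewrite ler_pM2l // mulr_gt0.
  have : N%:R * (K%:R * x * (rbinom w s * (rbinom w r - d%:R))) < N%:R * (r.*2%:R * rbinom w r).
    by rewrite ltr_pM2l.
  by lra.
apply: le_lt_trans h6; rewrite ler_pM2l; last lra.
apply: ler_wpM2r; first lra.
rewrite -rbinom_absorb -{1}[rbinom x s.+1]mul1r ler_pM2r ?ler1n //.
by apply: rbinom_gt0; rewrite -natr1; lra.
Qed.

Lemma full_rank_bound (R : realType) (T : finType) (r s : nat) (E : {set {set T}})
    (x : R) : (s <= r)%N -> uniform r.+1 E -> r.+1%:R <= x ->
  #|E|%:R = rbinom x r.+1 ->
  ('C(#|cover E|, s.+1) <= \rank (inclusion_mx s.+1 E))%N ->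
  rbinom x s.+1 <= (\rank (inclusion_mx s.+1 E))%:R.
Proof.
move=> sr uE rx cE; rewrite -(ler_nat R) -rbinom_nat; apply: le_trans.
apply: rbinom_le; last exact: le_card_cover cE.
by apply: (@le_trans _ _ r.+1%:R); [rewrite ler_nat | rewrite (le_trans rx) ?lerDl].
Qed.

(** Equality squeezes b_(s+1)(N) down to b_(s+1)(x), so N = x by strict monotonicity; then [E] has
    as many edges as the complete hypergraph on its cover. *)
Lemma full_rank_eq (R : realType) (T : finType) (r s : nat) (E : {set {set T}})
    (x : R) : (s <= r)%N -> uniform r.+1 E -> r.+1%:R <= x ->
  #|E|%:R = rbinom x r.+1 ->
  ('C(#|cover E|, s.+1) <= \rank (inclusion_mx s.+1 E))%N ->
  (\rank (inclusion_mx s.+1 E))%:R = rbinom x s.+1 ->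
  #|cover E|%:R = x /\ E = subsets_of_card r.+1 (cover E).
Proof.
move=> sr uE rx cE; rewrite -(ler_nat R) -rbinom_nat => + rkE; rewrite rkE => Nx.
have eN : #|cover E|%:R = x.
  apply/eqP; rewrite eq_le (le_card_cover uE rx cE) andbT leNgt; apply/negP => lt.
  move: Nx; rewrite leNgt => /negP; apply; apply: rbinom_lt => //.
  by apply: (@le_trans _ _ r.+1%:R); [rewrite ler_nat | rewrite (le_trans rx) ?lerDl].
split=> //; apply/eqP; rewrite eqEcard sub_subsets_cover //= card_subsets.
by rewrite -(ler_nat R) cE -rbinom_nat eN.
Qed.

(* Since the harmonic series diverges, the deficit cannot keep growing by
   [1 / (K x)] while [x] drops by at most 1 and the deficit stays bounded. *)
Lemma rank_bound_step (r s n1 : nat) : (s < r)%N -> rank_bound r s n1 ->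
  exists n : nat,
    forall (R : realType) (T : finType) (E : {set {set T}}) (x : R),
      uniform r.+1 E -> r.+1%:R <= x -> #|E|%:R = rbinom x r.+1 -> (n <= #|E|)%N ->
      rbinom x s.+1 <= (\rank (inclusion_mx s.+1 E))%:R /\
      ((\rank (inclusion_mx s.+1 E))%:R = rbinom x s.+1 ->
       exists Y : {set T}, #|Y|%:R = x /\ E = subsets_of_card r.+1 Y).
Proof.
move=> sr bnd; have [K [X [K0 rX step]]] := delete_or_full sr bnd.
pose C := 'C(X.+1, s.+1).
pose H (R : realType) m : R := \sum_(i < m) (X.+1 + i).+1%:R^-1.
have pos (R : realType) (x : R) : X%:R <= x -> 0 < (K%:R * x)^-1.
  move=> Xx; rewrite invr_gt0 mulr_gt0 ?ltr0n //.
  by apply: lt_le_trans Xx; rewrite ltr0n; apply: leq_trans rX.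
have Xr (R : realType) (x : R) : X%:R <= x -> r.+1%:R <= x.
  by apply: le_trans; rewrite ler_nat.
have XmX m (R : realType) (x : R) : (X + m)%:R <= x -> X%:R <= x.
  by apply: le_trans; rewrite ler_nat leq_addr.
(* The outer induction counts unit steps of [x] above [X]; the inner one is on the number of edges,
   for deletions that stay within the same step. *)
have descent m (R : realType) (T : finType) n (E : {set {set T}}) (x : R) :
    (#|E| < n)%N -> uniform r.+1 E -> (X + m)%:R <= x -> #|E|%:R = rbinom x r.+1 ->
    rbinom x s.+1 <= (\rank (inclusion_mx s.+1 E))%:R \/
    rbinom x s.+1 - (\rank (inclusion_mx s.+1 E))%:R + H R m / K%:R <= C%:R.
  elim: m n E x => [|m IHm]; elim=> // n IHn E x; rewrite ltnS => En uE Xmx cE;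
    have Xx := XmX _ _ _ Xmx; have Kx := pos _ _ Xx; have rx := Xr _ _ Xx;
    (have [[v [z [/andP[xz zx] cz lt gain]]] | full] := step R T E x uE Xx cE;
      last by left; apply: full_rank_bound (ltnW sr) uE rx cE full);
    have uD := uniform_del (v := v) uE.
  - have [zX | zX] := ltP z X%:R; last first.
      case: (IHn _ z (leq_trans lt En) uD _ cz); rewrite ?addn0 // => h; [left | right]; lra.
    (* Now z < X, so x < X + 1 and the deficit is at most b_(s+1)(x) <= [C]. *)
    right; rewrite /H big_ord0 mul0r addr0.
    apply: (@le_trans _ _ (rbinom x s.+1)); first by rewrite gerBl.
    rewrite /C -rbinom_nat; apply: rbinom_le; last by rewrite -natr1; lra.
    rewrite -natr1 lerD2r; apply: le_trans rx; rewrite ler_nat; exact: leqW (ltnW sr).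
  - have [zX | zX] := ltP z (X + m.+1)%:R; last first.
      case: (IHn _ z (leq_trans lt En) uD _ cz) => // h; [left | right]; lra.
    (* The deletion crosses X+m+1, so x < X+m+2 and 1/(Kx) pays for the last term of [H R m.+1]. *)
    have Xmz : (X + m)%:R <= z by move: Xmx; rewrite addnS -natr1; lra.
    case: (IHm _ _ z lt uD Xmz cz) => h; [left; lra | right].
    rewrite /H big_ord_recr /= mulrDl -/(H R m).
    apply: le_trans h; rewrite [H R m / _ + _]addrC addrA lerD2r.
    apply: le_trans gain; rewrite lerD2l.
    have x0 : 0 < x by apply: lt_le_trans rx; rewrite ltr0n.
    rewrite -invfM lef_pV2 ?posrE ?mulr_gt0 ?ltr0n // [leRHS]mulrC ler_pM2l ?ltr0n //.
    by move: zX; rewrite addnS addSn -[(X + m).+2%:R]natr1; lra.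
have [m hm] := harmonic_unbounded X.+1 (C * K).+1.
have bound (R : realType) (T : finType) (E : {set {set T}}) (x : R) :
    uniform r.+1 E -> (X + m)%:R <= x -> #|E|%:R = rbinom x r.+1 ->
    rbinom x s.+1 <= (\rank (inclusion_mx s.+1 E))%:R.
  move=> uE Xmx /(descent m R T _ E x (ltnSn _) uE Xmx)[//|h].
  have : C%:R <= H R m / K%:R.
    by rewrite ler_pdivlMr ?ltr0n // -natrM; apply: le_trans (hm R); rewrite ler_nat.
  by lra.
(* This forces x >= X+m+1, one above what [bound] asks, so that [bound] also covers the hypergraph
   after one deletion. *)
exists 'C((X + m).+1, r.+1).+1 => R T E x uE rx cE nE.
have Xmx : (X + m).+1%:R <= x.
  rewrite leNgt; apply/negP => lt; move: nE; rewrite -(ltr_nat R) cE -rbinom_nat ltNge.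
  by move/negP; apply; apply: rbinom_le; [lra | exact: ltW].
split; first by apply: bound => //; apply: le_trans Xmx; rewrite ler_nat.
move=> rkE; exists (cover E).
have Xx : X%:R <= x by apply: le_trans Xmx; rewrite ler_nat leqW ?leq_addr.
(* With deficit zero, the first alternative would give a positive deficit after deletion, against
   [bound]. *)
have [[v [z [/andP[xz zx] cz _ gain]]] | full] := step R T E x uE Xx cE; last first.
  exact: full_rank_eq (ltnW sr) uE rx cE full rkE.
have Xmz : (X + m)%:R <= z by move: Xmx; rewrite -natr1; lra.
have uD := uniform_del (v := v) uE.
have le_z := bound _ _ _ _ uD Xmz cz; have Kx := pos _ _ Xx; exfalso; lra.
Qed.

(** Induction on [s] for all [r], since passing to a link lowers both by one. *)
Lemma rank_bound_exists (r s : nat) : (s <= r)%N -> exists n, rank_bound r s n.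
Proof.
elim: s r => [|s IH] r.
  move=> _; exists 1%N => R T E x uE rx cE /card_gt0P[e eE].
  by rewrite rbinom0 ler1n; apply: rank_gt0 eE _.
case: r => // r; rewrite ltnS leq_eqVlt => /orP[/eqP -> | sr].
  by exists 0%N => R T E x uE rx <- _; rewrite ler_nat rank_diag.
have [n1 hn1] := IH r (ltnW sr).
have [n hn] := rank_bound_step sr hn1.
by exists n => R T E x uE rx cE nE; have [] := hn R T E x uE rx cE nE.
Qed.

Theorem theorem5 (r s : nat) (hsr : (s <= r)%N) :
  exists n : nat,
    forall (R : realType) (T : finType) (E : {set {set T}}) (x : R),
      uniform r E -> r%:R <= x ->
      #|E|%:R = rbinom x r -> (n <= #|E|)%N ->
      rbinom x s <= (\rank (inclusion_mx s E))%:R /\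
      ((0 < s)%N -> (s < r)%N ->
       (\rank (inclusion_mx s E))%:R = rbinom x s ->
       exists X : {set T}, #|X|%:R = x /\ E = subsets_of_card r X).
Proof.
case: s hsr => [|s]; first move=> hsr.
  have [n hn] := rank_bound_exists hsr.
  by exists n => R T E x uE rx cE nE; split => //; exact: hn.
case: r => // r; rewrite ltnS leq_eqVlt => /orP[/eqP -> | sr].
  have [n hn] := rank_bound_exists (leqnn r.+1).
  exists n => R T E x uE rx cE nE; split; first exact: hn.
  by rewrite ltnn.
have [n1 hn1] := rank_bound_exists (ltnW sr).
have [n hn] := rank_bound_step sr hn1.
exists n => R T E x uE rx cE nE.
by have [le0 eq0] := hn R T E x uE rx cE nE; split.
Qed.
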